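(* Let $H$ be a real Hilbert space and let $\{\phi_t;\ t\ge0\}$ be a family of closed convex proper functions from $H$ to $\mathbb R\cup\{+\infty\}$. Assume that $\phi_t\le\phi_s$ for all $s,t\ge0$ with $s\le t$. Set $\phi_\infty=\mathrm{cl}\,(\inf_{t\ge0}\phi_t)$. Let $x(\cdot)$ be a strong global solution of $$\dot x(t)+\partial\phi_t(x(t))\ni0,\qquad t\ge0,$$ such that the function $t\mapsto\phi_t(x(t))$ is locally absolutely continuous. Then: (i) The function $t\mapsto\phi_t(x(t))$ is nonincreasing, and $\lim_{t\to+\infty}\phi_t(x(t))=\inf_H\phi_\infty$. (ii) If additionally $\inf_H\phi_\infty>-\infty$, then $\int_0^{+\infty}\|\dot x(t)\|^2\,dt<+\infty$. (iii) If additionally $\inf_H\phi_\infty>-\infty$ and moreover $S_\infty=\mathrm{argmin}\,\phi_\infty\neq\emptyset$ and $$\forall z\in S_\infty,\qquad \int_0^{+\infty}G_{\partial\phi_t}(z,0)\,dt<+\infty,$$ then there exists $x_\infty\in S_\infty$ such that $x(t)\rightharpoonup x_\infty$ weakly in $H$ as $t\to+\infty$.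
   Context: $H$ is a real Hilbert space with scalar product $\langle\cdot,\cdot\rangle$ and norm $\|\cdot\|$. ''Closed'' means lower semicontinuous; a function is proper if its domain $\mathrm{dom}\,f=\{f<+\infty\}$ is nonempty. $\mathrm{cl}\,f$ denotes the lower semicontinuous regularization of $f$ (largest lower semicontinuous minorant). The subdifferential is $\partial f(x)=\{p\in H: f(y)\ge f(x)+\langle p,y-x\rangle\ \forall y\in H\}$ for $x\in\mathrm{dom} f$ (empty otherwise). For a maximal monotone operator $M:H\rightrightarrows H$, the Brézis–Haraux function is $G_M(x,u)=\sup_{(y,v)\in\mathrm{gph}\,M}\langle x-y,v-u\rangle$, where $\mathrm{gph}\,M=\{(y,v):v\in My\}$. A strong global solution is a function $x:[0,+\infty[\to H$, absolutely continuous on every bounded interval $[0,T]$, satisfying the inclusion for almost every $t>0$. *)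

(* Defs.v *)
From mathcomp Require Export all_boot all_order all_algebra.
From mathcomp Require Export sesquilinear.
From mathcomp Require Export all_classical all_reals all_analysis.

Set Implicit Arguments.
Unset Strict Implicit.
Unset Printing Implicit Defensive.

Export Order.TTheory GRing.Theory Num.Theory.
Export numFieldNormedType.Exports.

#[export] Set Implicit Arguments.
#[export] Unset Strict Implicit.
#[export] Unset Printing Implicit Defensive.

Local Open Scope classical_set_scope.
Local Open Scope ring_scope.

Section ConvexAnalysis.
Context {R : realType} {H : completeNormedModType R}.
Implicit Types (f g : H -> \bar R) (x y z u v p : H).
Local Open Scope ereal_scope.

(* f takes values in R \cup {+oo} and is not identically +oo *)
Definition proper f := (forall x, -oo < f x) /\ (exists x, f x < +oo).

(* Only used for functions that never take the value -oo, so that the sum on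
   the right-hand side is never of the form +oo - oo. *)
Definition econvex f := forall x y (a : R), (0 < a < 1)%R ->
  f (a *: x + (1 - a) *: y)%R <= a%:E * f x + (1 - a)%:E * f y.

Definition closed_convex_proper f :=
  [/\ lower_semicontinuous f, econvex f & proper f].

(* Minorants range over functions with values in [-oo, +oo], since f itself may
   take the value -oo or have no minorant that is finite everywhere. *)
Definition lsc_hull f x : \bar R :=
  ereal_sup [set g x | g in
    [set g | lower_semicontinuous g /\ forall y, g y <= f y]].

Definition einf f : \bar R := ereal_inf (range f).

Definition argmin f : set H := [set z | f z = einf f].

Definition subdifferential (ip : H -> H -> R) f x : set H :=
  [set p | f x < +oo /\ forall y, f x + (ip p (y - x)%R)%:E <= f y].

Definition brezis_haraux (ip : H -> H -> R) (M : H -> set H) x u : \bar R :=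
  ereal_sup [set (ip (x - w.1)%R (w.2 - u)%R)%:E | w in
    [set w : H * H | M w.1 w.2]].

Definition phi_infty (phi : R -> H -> \bar R) : H -> \bar R :=
  lsc_hull (fun y => ereal_inf [set phi t y | t in `[0%R, +oo[%classic]).

End ConvexAnalysis.

Section Trajectories.
Context {R : realType}.

(* The inequalities on u and v say that the open intervals ]u i, v i[ are
   pairwise disjoint and contained in [a, b]. *)
Definition abs_continuous_on {V : normedModType R} (a b : R) (f : R -> V) :=
  forall e : R, 0 < e -> exists2 d : R, 0 < d &
    forall (n : nat) (u v : 'I_n -> R),
      (forall i, [/\ a <= u i, u i <= v i & v i <= b]) ->
      (forall i j, i != j -> v i <= u j \/ v j <= u i) ->
      \sum_(i < n) (v i - u i) < d ->
      \sum_(i < n) `|f (v i) - f (u i)| < e.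

Definition locally_abs_continuous {V : normedModType R} (f : R -> V) :=
  forall T : R, 0 < T -> abs_continuous_on 0 T f.

(* Functions on [0, +oo[ are represented by total functions on R whose values
   at negative times play no role.  Derivability is part of the almost
   everywhere condition because x^`() has a default value elsewhere. *)
Definition strong_global_solution {H : completeNormedModType R}
    (ip : H -> H -> R) (phi : R -> H -> \bar R) (x : R -> H) :=
  locally_abs_continuous x /\
  {ae lebesgue_measure, forall t : R, 0 < t ->
     derivable x t 1 /\
     [set x^`()%classic t + p | p in subdifferential ip (phi t) (x t)] 0}.

Definition weak_cvg_pinfty {H : completeNormedModType R}
    (ip : H -> H -> R) (x : R -> H) (l : H) :=
  forall y : H, ip (x t) y @[t --> +oo] --> ip l y.

End Trajectories.

(* Main.v *)
Require Import Defs.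
From mathcomp Require Import ring lra measurable_realfun.

Local Open Scope classical_set_scope.
Local Open Scope ring_scope.

(** Write h(t) = phi_t(x(t)) and m = inf phi_infty.

    _Energy._ Since phi_t <= phi_s for s <= t, the subgradient inequality at
    time t, read at the point x(s), bounds the left increments of h:
    h(t) - h(s) <= - <x'(t), x(t) - x(s)>.  Hence h has left slopes at most
    - |x'(t)|^2 at almost every t.  Only left increments are controlled, which
    is why the passage from slopes to increments ([ac_comparison]) is done for
    one-sided slopes: an open set of small measure that contains the exceptional
    times contributes little because h is absolutely continuous, and everywhere
    else one can step to the left.  This gives that h is nonincreasing and that
    the integral of |x'|^2 is at most h(0) - m.

    _Limit._ If h stayed above c > phi_T(y), the subgradient inequality read at
    y would give |x(t) - y|^2 / 2 a slope at most phi_T(y) - c < 0 after time T,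
    and a nonnegative function cannot decrease at a constant rate forever.  So h
    gets below every value taken by some phi_T, that is, h decreases to m
    ([energy_cvg]).

    _Distances._ For z in S_infty, the derivative of |x(t) - z|^2 / 2 is
    <x'(t), x(t) - z>, one of the numbers whose supremum is the Brezis-Haraux
    function at (z, 0).  That function is nonnegative because the proximal point
    y of z satisfies z - y in the subdifferential at y
    ([prox_subdifferential]).  So the positive part of the derivative is
    integrable and |x(t) - z| converges ([sqr_dist_cvg]).

    _Weak convergence._ This is Opial's argument, with a notion of weak cluster
    point that avoids weak compactness: p is a cluster point along a set P of
    times if it is adherent to every convex set that contains x(t) for all large
    t in P.  These convex sets form a directed family with a bounded member, and
    in a Hilbert space such a family always has a common adherent point
    ([directed_midconvex_cluster]): points of almost minimal norm are Cauchy by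
    the parallelogram identity.  Applied to the sets of points where some phi_t
    is below c, for c > m, cluster points minimize phi_infty; applied to
    half-spaces, the convergence of |x(t) - z| for z in S_infty makes cluster
    points unique ([weak_cluster_unique]) and uniqueness along all P gives weak
    convergence ([opial]). *)

(** * Inner products and directed families of convex sets *)

Section InnerProduct.
Context {R : realType} {H : completeNormedModType R} (ip : {dot H for idfun}).
Implicit Types (u v w : H) (a : R).

Lemma ipC u v : ip u v = ip v u.
Proof. by rewrite hermC /= expr0 mul1r. Qed.

Lemma ipDl u v w : ip (u + v) w = ip u w + ip v w.
Proof. exact: linearDl. Qed.

Lemma ipBl u v w : ip (u - v) w = ip u w - ip v w.
Proof. exact: linearBl. Qed.

Lemma ipZl a u v : ip (a *: u) v = a * ip u v.
Proof. exact: linearZl_LR. Qed.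

Lemma ipDr u v w : ip w (u + v) = ip w u + ip w v.
Proof. exact: linearDr. Qed.

Lemma ipBr u v w : ip w (u - v) = ip w u - ip w v.
Proof. exact: linearBr. Qed.

Lemma ipZr a u v : ip v (a *: u) = a * ip v u.
Proof. exact: linearZr_LR. Qed.

Lemma ipNl u v : ip (- u) v = - ip u v.
Proof. exact: linearNl. Qed.

Lemma ipNr u v : ip v (- u) = - ip v u.
Proof. exact: linearNr. Qed.

Lemma ip0l u : ip 0 u = 0.
Proof. exact: linear0l. Qed.

Lemma ip0r u : ip u 0 = 0.
Proof. exact: linear0r. Qed.

Definition ipE := (ipDl, ipBl, ipDr, ipBr, ipZl, ipZr, ipNl, ipNr, ip0l, ip0r).

Hypothesis ip_norm : forall u : H, ip u u = `|u| ^+ 2.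

Lemma sqr_normB u v : `|u - v| ^+ 2 = `|u| ^+ 2 - 2 * ip u v + `|v| ^+ 2.
Proof. by rewrite -!ip_norm !ipE (ipC v u); lra. Qed.

Lemma sqr_normD u v : `|u + v| ^+ 2 = `|u| ^+ 2 + 2 * ip u v + `|v| ^+ 2.
Proof. by rewrite -!ip_norm !ipE (ipC v u); lra. Qed.

Lemma ip_cauchy_schwarz u v : `|ip u v| <= `|u| * `|v|.
Proof.
have [v0|v0] := eqVneq `|v| 0.
  by move/eqP: v0; rewrite normr_eq0 => /eqP ->; rewrite ip0r !normr0 mulr0.
have v2 : 0 < `|v| ^+ 2 by rewrite exprn_gt0// lt_def v0 normr_ge0.
have := sqr_ge0 `| `|v| ^+ 2 *: u - ip u v *: v|.
rewrite sqr_normB !normrZ !exprMn !ipE => h.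
rewrite -(@ler_pXn2r _ 2)// ?nnegrE ?mulr_ge0//.
rewrite exprMn real_normK ?num_real// -(ler_pM2l v2).
move: h; rewrite !real_normK ?num_real//.
set A := `|u| ^+ 2; set B := `|v| ^+ 2; set c := ip u v; nra.
Qed.

Lemma parallelogram u v :
  `|u - v| ^+ 2 = 2 * `|u| ^+ 2 + 2 * `|v| ^+ 2 - 4 * `|2^-1 *: (u + v)| ^+ 2.
Proof.
rewrite normrZ exprMn sqr_normB sqr_normD ger0_norm; last by lra.
by field.
Qed.

End InnerProduct.

(** Midpoint convexity suffices below, since only the parallelogram identity
    is applied to members of the families. *)
Definition midconvex {R : realType} {H : lmodType R} (C : set H) :=
  forall u v, C u -> C v -> C (2^-1 *: (u + v)).

Section Cluster.
Context {R : realType} {H : completeNormedModType R} (ip : {dot H for idfun}).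
Hypothesis ip_norm : forall u : H, ip u u = `|u| ^+ 2.

(** Substitute for weak compactness of bounded closed convex sets.  Let d be
    the supremum over A in F of the least squared norm on A.  The sets
    A `&` {|y|^2 < d + e} are nonempty; when the least squared norm on A exceeds
    d - e, midpoints of two such points also have squared norm at least d - e,
    so the parallelogram identity makes the set small.  These sets therefore
    generate a Cauchy filter, and its limit is adherent to every A. *)
Lemma directed_midconvex_cluster (F : set (set H)) (r : R) (A0 : set H) :
  (forall A B, F A -> F B -> exists2 C, F C & C `<=` A `&` B) ->
  (forall A, F A -> A !=set0 /\ midconvex A) ->
  F A0 -> (forall y, A0 y -> `|y| <= r) ->
  exists p, forall A, F A -> closure A p.
Proof.
move=> FI Fne FA0 A0r.
pose S (A : set H) : set R := [set `|y| ^+ 2 | y in A].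
have hinf A : F A -> has_inf (S A).
  move=> FA; have [[y Ay] _] := Fne _ FA; split; first by exists (`|y| ^+ 2), y.
  by exists 0 => _ [z _ <-]; rewrite sqr_ge0.
have infle A y : F A -> A y -> inf (S A) <= `|y| ^+ 2.
  by move=> FA Ay; apply: ge_inf; [exact: (hinf _ FA).2|exists y].
have subinf A : F A -> inf (S A) <= r ^+ 2.
  move=> FA; have [C FC CA] := FI _ _ FA FA0.
  have [[y /CA[Ay A0y]] _] := Fne _ FC.
  by rewrite (le_trans (infle _ _ FA Ay))// lerXn2r ?nnegrE// ?A0r// (le_trans _ (A0r _ A0y)).
pose D : set R := [set inf (S A) | A in F].
have supD : has_sup D.
  split; first by exists (inf (S A0)), A0.
  by exists (r ^+ 2) => _ [A FA <-]; exact: subinf.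
pose d := sup D.
pose B (Ae : set H * R) := Ae.1 `&` [set y | `|y| ^+ 2 < d + Ae.2].
pose I := [set Ae : set H * R | F Ae.1 /\ 0 < Ae.2].
have PG : ProperFilter (filter_from I B).
  apply: filter_from_proper; last first.
    move=> [A e] [/= FA e0].
    have [_ [y Ay <-] ylt] := @inf_adherent _ (S A) e e0 (hinf _ FA).
    exists y; split => //=; rewrite (lt_le_trans ylt)// lerD2r.
    by apply: ub_le_sup; [exact: supD.2|exists A].
  apply: filter_from_filter; first by exists (A0, 1).
  move=> [A e] [A' e'] [/= FA e0] [/= FA' e'0].
  have [C FC CA] := FI _ _ FA FA'; exists (C, Num.min e e').
    by split => //=; rewrite lt_min e0.
  move=> y [/= /CA[Ay A'y]]; rewrite addr_minr lt_min => /andP[y1 y2].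
  by split; split.
have : cauchy (filter_from I B).
  apply/cauchy_ballP => e e0.
  pose e1 := e ^+ 2 / 8.
  have e10 : 0 < e1 by rewrite divr_gt0// exprn_gt0.
  have [_ [A FA <-] Ad] := sup_adherent e10 supD.
  exists (B (A, e1), B (A, e1)) => /=.
    by split; exists (A, e1).
  move=> [u v] /= [[/= Au u1] [/= Av v1]].
  rewrite -ball_normE /= -(@ltr_pXn2r _ 2)// ?nnegrE ?(ltW e0)//.
  rewrite (parallelogram ip_norm).
  have := infle _ _ FA ((Fne _ FA).2 _ _ Au Av).
  rewrite -/d in Ad; rewrite /e1 in u1 v1 Ad; lra.
move=> /cauchy_cvg /cvg_ex[p Gp].
exists p => A FA V Vp.
have [[A' e] [/= FA' e0] sub] := Gp _ Vp.
have [C FC CA] := FI _ _ FA' FA.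
have [y [/= /CA[A'y Ay] ylt]] : B (C, e) !=set0.
  by apply: (filter_ex (F := filter_from I B)); exists (C, e).
by exists y; split => //; apply: sub; split.
Qed.

End Cluster.

(** * Proximal points *)

Section Prox.
Context {R : realType} {H : completeNormedModType R} (ip : {dot H for idfun}).
Hypothesis ip_norm : forall u : H, ip u u = `|u| ^+ 2.

Lemma econvex_le (f : H -> \bar R) (u v : H) (a b c : R) : econvex f ->
  0 < a < 1 -> (f u <= b%:E)%E -> (f v <= c%:E)%E ->
  (f (a *: u + (1 - a) *: v)%R <= (a * b + (1 - a) * c)%:E)%E.
Proof.
move=> cf a01 ub vc; apply: (le_trans (cf _ _ _ a01)).
case/andP: a01 => a0 a1.
by rewrite (EFinD (a * b)); apply: leeD; rewrite EFinM lee_pmul2l// lte_fin subr_gt0.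
Qed.

(** The point y minimizes f + |. - z|^2 / 2, and z - y in the subdifferential
    is the first-order condition.  Sublevel sets of that function at levels
    decreasing to its infimum are nested, convex and bounded, so they have a
    common adherent point, and lower semicontinuity makes it a minimizer. *)
Lemma prox_subdifferential (f : H -> \bar R) (m : R) (z : H) :
  closed_convex_proper f -> (forall y, m%:E <= f y)%E ->
  exists y, subdifferential ip f y (z - y).
Proof.
move=> [lf cf [fNy [y0 fy0]]] mf.
pose q (y : H) : R := `|y - z| ^+ 2 / 2.
have q0 y : 0 <= q y by rewrite divr_ge0// sqr_ge0.
pose D : set R := [set r : R | exists y, (f y <= (r - q y)%:E)%E].
have lbD : lbound D m.
  move=> r [y fyr]; have := le_trans (mf y) fyr; rewrite lee_fin.
  by move: (q0 y); lra.
have infD : has_inf D.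
  split; last by exists m.
  exists (fine (f y0) + q y0), y0; rewrite addrK fineK//.
  by rewrite fin_real// fNy.
pose mu := inf D.
pose C (e : R) := [set y | (f y <= (mu + e - q y)%:E)%E].
pose F : set (set H) := [set C e | e in [set e : R | 0 < e]].
have qmid u v : q (2^-1 *: (u + v)) <= (q u + q v) / 2.
  have := parallelogram ip_norm (u - z) (v - z).
  have -> : 2^-1 *: (u - z + (v - z)) = 2^-1 *: (u + v) - z.
    rewrite addrACA scalerDr -opprD scalerN; congr (_ - _).
    by rewrite -mulr2n -[z *+ 2]scaler_nat scalerA mulVf ?scale1r.
  by have := sqr_ge0 `|u - z - (v - z)|; rewrite /q; lra.
have [p pP] : exists p, forall A, F A -> closure A p.
  apply: (@directed_midconvex_cluster R H ip ip_norm F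
    (`|z| + (2 * (mu + 1 - m) + 1)) (C 1)).
  - move=> _ _ [e /= e0 <-] [e' /= e'0 <-].
    have Cle e1 e2 : e1 <= e2 -> C e1 `<=` C e2.
      move=> e12 y /le_trans; apply; rewrite lee_fin; lra.
    case: (leP e e') => [ee'|/ltW e'e].
      by exists (C e) => [|y Cy]; [exists e|split=> //; exact: Cle Cy].
    by exists (C e') => [|y Cy]; [exists e'|split=> //; exact: Cle Cy].
  - move=> _ [e /= e0 <-]; split.
      have [r [y fyr] rlt] := inf_adherent e0 infD.
      by exists y; apply: (le_trans fyr); rewrite lee_fin; move: rlt; rewrite -/mu; lra.
    move=> u v Cu Cv; rewrite /C /= scalerDr.
    have -> : 2^-1 *: v = (1 - 2^-1) *: v by congr (_ *: _); lra.
    have h2 : 0 < (2^-1 : R) < 1 by apply/andP; split; lra.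
    apply: (le_trans (econvex_le cf h2 Cu Cv)); rewrite lee_fin.
    have := qmid u v; rewrite scalerDr.
    have -> : 2^-1 *: v = (1 - 2^-1) *: v by congr (_ *: _); lra.
    lra.
  - by exists 1 => //=.
  - move=> y Cy; have := le_trans (mf y) Cy; rewrite lee_fin /q => h.
    have : `|y| <= `|z| + `|y - z|.
      by rewrite -{1}(subrK z y) addrC ler_normD.
    have := normr_ge0 (y - z); nra.
(* Suppose that f p exceeds mu - q p by more than 2 e.  So does f y for y near p,
   by lower semicontinuity, whereas f y <= mu - q p + 2 e for y in C e near p:
   one e comes from the level of C e, the other from the continuity of q. *)
have fp : (f p <= (mu - q p)%:E)%E.
  rewrite leNgt; apply/negP => fpgt.
  have [e e0 fpe] : exists2 e, 0 < e & ((mu - q p + 2 * e)%:E < f p)%E.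
    case: (f p) fpgt (fNy p) => [s| |]//; last by exists 1 => //; rewrite ltry.
    rewrite lte_fin => h _; exists ((s - (mu - q p)) / 4); first by lra.
    by rewrite lte_fin; lra.
  have [V Vp Vf] := lf _ _ fpe.
  have qc : q y @[y --> p] --> q p.
    have nc : `|y - z| @[y --> p] --> `|p - z|.
      by apply: cvg_norm; apply: cvgB; [exact: cvg_id|exact: cvg_cst].
    have nc2 : `|y - z| * `|y - z| @[y --> p] --> `|p - z| * `|p - z| by exact: cvgM.
    by apply: (cvgM nc2); exact: cvg_cst.
  have Vq : nbhs p [set y | q p - e < q y].
    by apply: (cvgr_gt _ qc); rewrite ltrBlDr ltrDl.
  have [y [Cy [Vy qy]]] : C e `&` (V `&` [set y | q p - e < q y]) !=set0.
    by apply: pP; [exists e|exact: filterI].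
  have := lt_le_trans (Vf _ Vy) Cy; rewrite lte_fin.
  by move: qy => /=; lra.
exists p; split; first exact: (le_lt_trans fp (ltry _)).
move=> w; case fw: (f w) (fNy w) => [W| |]// _; last exact: leey.
case fpP: (f p) fp (fNy p) => [P| |]// + _; rewrite lee_fin => fp.
rewrite -EFinD lee_fin leNgt; apply/negP => gap.
(* If the subgradient inequality failed at w by g, moving from p towards w by a
   fraction a would change f + q by at most - a g + a^2 N / 2, which is negative
   for the small a chosen here. *)
pose g := P + ip (z - p) (w - p) - W; pose N := `|w - p| ^+ 2.
have g0 : 0 < g by rewrite /g; lra.
have N0 : 0 <= N by exact: sqr_ge0.
pose a := g / (g + N + 1).
have a0 : 0 < a by rewrite divr_gt0//; lra.
have a1 : a < 1 by rewrite ltr_pdivrMr; lra.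
have aN : a * N < g.
  by rewrite /a mulrAC ltr_pdivrMr; [nra|lra].
have /(_ f) := @econvex_le _ w p a W P.
rewrite fw fpP a0 a1 => /(_ cf isT (lexx _) (lexx _)) fa.
set y := (a *: w + (1 - a) *: p)%R in fa.
have : mu <= a * W + (1 - a) * P + q y.
  by apply: ge_inf; [exact: infD.2|exists y; rewrite addrK].
have -> : q y = q p - a * ip (z - p) (w - p) + a ^+ 2 * N / 2.
  rewrite /q /N; have -> : y - z = a *: (w - p) - (z - p).
    by rewrite /y scalerBr scalerBl scale1r opprB (addrC p (- (a *: p))) !addrA.
  rewrite (sqr_normB ip_norm (a *: (w - p))) normrZ exprMn real_normK ?num_real//.
    by rewrite ipZl (ipC _ (w - p)) (distrC z p); lra.
rewrite expr2 => h.
have : a * g <= a * (a * N / 2) by rewrite /g; lra.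
by rewrite ler_pM2l//; lra.
Qed.

(** At the proximal point y of z, the pair (y, z - y) of the graph contributes
    |z - y|^2 to the supremum. *)
Lemma brezis_haraux_ge0 (f : H -> \bar R) (m : R) (z : H) :
  closed_convex_proper f -> (forall y, m%:E <= f y)%E ->
  (0%E <= brezis_haraux ip (subdifferential ip f) z 0%R)%E.
Proof.
move=> ccp mf; have [y zy] := prox_subdifferential z ccp mf.
apply: (@le_trans _ _ (ip (z - y) (z - y - 0))%:E).
  by rewrite subr0 ip_norm lee_fin sqr_ge0.
by apply: ereal_sup_ubound; exists (y, z - y).
Qed.

End Prox.

(** * Comparison of absolutely continuous functions *)

Section Chain.
Context {R : realType}.
Notation mu := (@lebesgue_measure R).
Implicit Types (U : set R) (a b s t : R) (l : seq (R * R)).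

(** A partial subdivision of [t, b] lying in U.  It is a list rather than a
    family indexed by ordinals because the proof of [ac_comparison] prolongs it
    by one interval on the left. *)
Fixpoint chain U b t l : Prop :=
  if l is p :: l' then
    [/\ t <= p.1, p.1 <= p.2, `[p.1, p.2] `<=` U & chain U b p.2 l']
  else t <= b.

Lemma chain_widen U b s t l : s <= t -> chain U b t l -> chain U b s l.
Proof.
case: l => [|p l] st /=; first exact: le_trans.
by move=> [/(le_trans st)].
Qed.

Lemma chain_le U b t l : chain U b t l -> t <= b.
Proof.
elim: l t => //= p l IH t [tp pp _ /IH]; apply: le_trans.
exact: le_trans pp.
Qed.

Lemma chain_nth U b t l i p0 : chain U b t l -> (i < size l)%N ->
  [/\ t <= (nth p0 l i).1, (nth p0 l i).1 <= (nth p0 l i).2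
    & (nth p0 l i).2 <= b].
Proof.
elim: l t i => // p l IH t [|i] /= [tp pp pU ch].
  by split => //; exact: chain_le ch.
rewrite ltnS => /(IH _ _ ch)[h1 h2 h3]; split => //.
exact: (le_trans tp (le_trans pp h1)).
Qed.

Lemma chain_disjoint U b t l i j p0 : chain U b t l ->
  (i < j)%N -> (j < size l)%N -> (nth p0 l i).2 <= (nth p0 l j).1.
Proof.
elim: l t i j => // p l IH t [|i] [|j] //= [tp pp pU ch].
  by move=> _ /(chain_nth p0 ch)[].
by rewrite ltnS => ij; rewrite ltnS; exact: IH ch ij.
Qed.

Lemma chain_length U b t l : measurable U -> chain U b t l ->
  ((\sum_(p <- l) (p.2 - p.1))%:E <= mu (U `&` `[t, b]))%E.
Proof.
move=> mU; elim: l t => [|p l IH] t /=.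
  by rewrite big_nil measure_ge0.
move=> [tp pp pU ch]; rewrite big_cons EFinD.
have pb := chain_le ch.
have mUI (I : interval R) : measurable (U `&` [set` I]).
  by apply: measurableI => //; exact: measurable_itv.
apply: (@le_trans _ _ (mu (U `&` `[t, p.2[) + mu (U `&` `[p.2, b]))%E).
  apply: leeD; last exact: IH.
  have -> : (p.2 - p.1)%:E = mu `[p.1, p.2[.
    rewrite lebesgue_measure_itv /= lte_fin.
    by case: ltgtP pp => // ->; rewrite subrr.
  apply: le_measure; rewrite ?inE//; first exact: mUI.
  move=> y /=; rewrite ?in_itv /= => /andP[y1 y2]; split.
    by apply: pU; rewrite /= in_itv /= y1 ltW.
  by rewrite y2 (le_trans tp).
rewrite -measureU; [|exact: mUI|exact: mUI|]; last first.
  apply/seteqP; split => y //= [[_ +] [_ +]]; rewrite ?in_itv /=.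
  by move=> /andP[_ y1] /andP[y2 _]; move: (lt_le_trans y1 y2); rewrite ltxx.
apply: le_measure; rewrite ?inE; [by apply: measurableU; exact: mUI|exact: mUI|].
move=> y [] [Uy] /=; rewrite ?in_itv /= => /andP[y1 y2]; split => //; rewrite ?in_itv /=.
  by rewrite y1 (le_trans (ltW y2) pb).
by rewrite y2 (le_trans tp)// (le_trans pp).
Qed.

(** The total length of a chain in U is at most the measure of U, so absolute
    continuity bounds the variation of F along it. *)
Lemma chain_variation (F : R -> R) a b : abs_continuous_on a b F ->
  forall e, 0 < e -> exists2 d, 0 < d & forall U l, measurable U ->
    (mu U < d%:E)%E -> chain U b a l -> \sum_(p <- l) `|F p.2 - F p.1| < e.
Proof.
move=> acF e /acF[d d0 Hd]; exists d => // U l mU Ud ch.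
have := Hd (size l) (fun i => (nth (0, 0) l i).1) (fun i => (nth (0, 0) l i).2).
rewrite !(big_nth (0, 0)) !big_mkord; apply => [i|i j ij|].
- exact: (chain_nth _ ch (ltn_ord i)).
- move: ij; rewrite -val_eqE neq_ltn => /orP[] ij; [left|right];
  exact: (chain_disjoint _ ch).
- rewrite -(big_mkord xpredT (fun i => (nth (0, 0) l i).2 - (nth (0, 0) l i).1)).
  rewrite -(big_nth (0, 0) xpredT (fun p => p.2 - p.1)) -lte_fin.
  apply: le_lt_trans Ud; apply: (le_trans (chain_length mU ch)).
  apply: le_measure; rewrite ?inE//.
  by apply: measurableI => //; exact: measurable_itv.
Qed.

Lemma abs_continuous_on_modulus {V : normedModType R} (F : R -> V) a b :
  abs_continuous_on a b F -> forall e, 0 < e -> exists2 d, 0 < d &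
    forall s t, a <= s -> s <= t -> t <= b -> t - s < d -> `|F t - F s| < e.
Proof.
move=> acF e /acF[d d0 Hd]; exists d => // s t hs st tb std.
have := Hd 1%N (fun=> s) (fun=> t); rewrite !big_ord1; apply => //.
by move=> i j; rewrite !ord1.
Qed.

Lemma negligible_open_cover (N : set R) d : mu.-negligible N -> 0 < d ->
  exists U, [/\ open U, N `<=` U & (mu U < d%:E)%E].
Proof.
move=> [A [mA A0 NA]] d0.
have [|U [oU AU Ud]] := lebesgue_regularity_outer mA _ d0.
  by move: A0 => /= ->; rewrite ltry.
exists U; split => //; first exact: subset_trans AU.
have mU := open_measurable oU.
rewrite (_ : U = (U `\` A) `|` A); last first.
  by rewrite setUC setDUK.
apply: le_lt_trans (measureU2 _ _ _) _ => //; first exact: measurableD.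
by move: A0 => /= ->; rewrite adde0.
Qed.

(** Walk to the left from b.  Let U be an open set of small measure containing
    the exceptional times.  Keep the times t from which the increment
    F b - F t is bounded by L b - L t, plus e (b - t), plus the variation of F on
    a chain of intervals in U.  The infimum of these times is again such a time,
    by continuity of F.  If it were larger than a, one could move further to the
    left: inside U by prolonging the chain, since L is nondecreasing, and outside
    U by the bound on left slopes.  At a, the chain contributes at most a third
    of the error.  As L only has to be nondecreasing, it may be the integral of
    an unbounded function. *)
Lemma ac_comparison (F L : R -> R) a b : a <= b -> abs_continuous_on a b F ->
  (forall s t, a <= s -> s <= t -> t <= b -> L s <= L t) ->
  {ae mu, forall t, a < t <= b -> forall e, 0 < e ->
     \forall s \near t^'-, F t - F s <= L t - L s + e * (t - s)} ->
  F b - F a <= L b - L a.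
Proof.
move=> ab acF Lmono aeF; apply/ler_addgt0Pr => eta eta0.
have eta3 : 0 < eta / 3 by lra.
pose e := eta / 3 / (b - a + 1).
have e0 : 0 < e by rewrite divr_gt0//; lra.
have eb : e * (b - a) <= eta / 3.
  by rewrite /e mulrAC ler_pdivrMr; [nra|lra].
have [d d0 Hd] := chain_variation acF eta3.
have [U [oU NU Ud]] := negligible_open_cover aeF d0.
have mU := open_measurable oU.
(* The slack k makes T stable under limits from the right: the chain may change
   with the point that approximates the infimum. *)
pose T := [set t | a <= t <= b /\ forall k, 0 < k -> exists2 l, chain U b t l &
  F b - F t <= L b - L t + e * (b - t) + \sum_(p <- l) `|F p.2 - F p.1| + k].
have Tb : T b.
  split; first by rewrite ab lexx.
  by move=> k k0; exists [::] => //=; rewrite big_nil; lra.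
have infT : has_inf T.
  by split; [exists b|exists a => t [/andP[]]].
pose tau := inf T.
have atau : a <= tau by apply: lb_le_inf; [exists b|move=> t [/andP[]]].
have taub : tau <= b by apply: ge_inf => //; exact: infT.2.
have Ttau : T tau.
  split; first by rewrite atau.
  move=> k k0; have k2 : 0 < k / 2 by lra.
  have [r r0 Hr] := abs_continuous_on_modulus acF k2.
  have [t [/andP[hat tb] Tt] tlt] := inf_adherent r0 infT.
  have taut : tau <= t by apply: ge_inf; [exact: infT.2|split => //; rewrite hat].
  have [l cl Hl] := Tt _ k2.
  exists l; first exact: chain_widen cl.
  have : `|F t - F tau| < k / 2 by apply: Hr => //; move: tlt; rewrite -/tau; lra.
  have := Lmono _ _ atau taut tb.
  have := ler_norm (F t - F tau).
  have : e * (b - t) <= e * (b - tau) by rewrite ler_pM2l//; lra.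
  lra.
have [taua|taua] := eqVneq tau a.
  have [l cl] := Ttau.2 _ eta3; rewrite taua in cl *.
  by have := Hd _ _ mU Ud cl; lra.
have {}taua : a < tau by rewrite lt_neqAle eq_sym taua.
have Tlb s : T s -> tau <= s by apply: ge_inf; exact: infT.2.
exfalso; have [Utau|Utau] := pselect (U tau).
  have [r /= r0 Ur] : nbhs_ball tau U by apply/nbhs_ballP/open_nbhs_nbhs.
  pose s := Num.max a (tau - r / 2).
  have hs : a <= s by rewrite le_max lexx.
  have rs : tau - r / 2 <= s by rewrite le_max lexx orbT.
  have stau : s < tau by rewrite gt_max taua; lra.
  suff /Tlb : T s by rewrite leNgt stau.
  split; first by rewrite hs ltW// (lt_le_trans stau).
  move=> k /(Ttau.2)[l cl Hl]; exists ((s, tau) :: l).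
    split => //=; first exact: ltW.
    move=> y /=; rewrite in_itv /= => /andP[y1 y2]; apply: Ur.
    by rewrite /ball /= ger0_norm; lra.
  rewrite big_cons /=.
  have := Lmono _ _ hs (ltW stau) taub.
  have := ler_norm (F tau - F s).
  have : e * (b - tau) <= e * (b - s) by rewrite ler_pM2l//; lra.
  lra.
have : ~ ~ (a < tau <= b -> forall e, 0 < e ->
     \forall s \near tau^'-, F tau - F s <= L tau - L s + e * (tau - s)).
  by move=> h; apply: Utau; apply: NU.
move/contrapT; rewrite taua taub => /(_ isT e e0) slope.
have slope' : \forall s \near tau^'-,
    [/\ F tau - F s <= L tau - L s + e * (tau - s), a <= s & s < tau].
  by near=> s; split; near: s; [exact: slope|exact: nbhs_left_ge|exact: nbhs_left_lt].
have [s [Hs hs stau]] := @filter_ex _ _ (at_left_proper_filter tau) _ slope'.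
suff /Tlb : T s by rewrite leNgt stau.
split; first by rewrite hs ltW// (lt_le_trans stau).
move=> k /(Ttau.2)[l cl Hl]; exists l; first by apply: chain_widen cl; exact: ltW.
lra.
Unshelve. all: by end_near. Qed.

(** First-order expansion on the left of t, with a remainder controlled by
    e (t - s); this is the form in which derivatives enter [ac_comparison]. *)
Lemma derivable_left_increment {V : normedModType R} (x : R -> V) t :
  derivable x t 1 -> forall e, 0 < e -> \forall s \near t^'-,
    `|x t - x s - (t - s) *: x^`()%classic t| <= e * (t - s).
Proof.
move=> dx e e0; rewrite derive1E.
have /cvgrPdist_le/(_ _ e0)/nbhs_ballP[d /= d0 Hd] := dx.
near=> s.
have st : s < t by near: s; exact: nbhs_left_lt.
have dst : t - d < s by near: s; apply: nbhs_left_gt; rewrite ltrBlDr ltrDl.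
have /= := Hd (s - t); rewrite /ball /= sub0r normrN.
have -> : (s - t) *: (1 : R) + t = s by rewrite /GRing.scale /= mulr1 subrK.
rewrite ltr0_norm ?subr_lt0// opprB ltrBlDl -ltrBlDr subr_eq0 => /(_ dst).
rewrite lt_eqF// => /(_ isT) He.
have -> : x t - x s - (t - s) *: 'D_1 x t =
    (t - s) *: ((s - t)^-1 *: (x s - x t) - 'D_1 x t).
  rewrite scalerBr scalerA -(opprB t s) invrN mulrN divff ?subr_eq0 ?gt_eqF//.
  by rewrite scaleN1r opprB.
rewrite normrZ gtr0_norm ?subr_gt0// mulrC ler_pM2r ?subr_gt0//.
by rewrite distrC.
Unshelve. all: by end_near. Qed.

End Chain.

Section AC.
Context {R : realType}.
Notation mu := (@lebesgue_measure R).

Lemma abs_continuous_onS {V : normedModType R} (F : R -> V) a b a' b' :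
  a <= a' -> b' <= b -> abs_continuous_on a b F -> abs_continuous_on a' b' F.
Proof.
move=> aa bb acF e /acF[d d0 Hd]; exists d => // n u v uv; apply: Hd => i.
by have [h1 h2 h3] := uv i; split => //; [exact: le_trans h1|exact: le_trans bb].
Qed.

Lemma abs_continuous_onDlin (F : R -> R) a b c :
  abs_continuous_on a b F -> abs_continuous_on a b (fun t => F t + c * t).
Proof.
move=> acF e e0; have e2 : 0 < e / 2 by lra.
have [d d0 Hd] := acF _ e2.
have c0 : 0 < `|c| + 1 by have := normr_ge0 c; lra.
exists (Num.min d (e / 2 / (`|c| + 1))).
  by rewrite lt_min d0 divr_gt0.
move=> n u v uv dis; rewrite lt_min => /andP[ud ue].
apply: (@le_lt_trans _ _ (\sum_(i < n) `|F (v i) - F (u i)| +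
    (`|c| + 1) * \sum_(i < n) (v i - u i))).
  rewrite mulr_sumr -big_split; apply: ler_sum => i _ /=.
  have -> : F (v i) + c * v i - (F (u i) + c * u i) =
    F (v i) - F (u i) + c * (v i - u i) by ring.
  apply: (le_trans (ler_normD _ _)); rewrite lerD2l normrM.
  have [_ h _] := uv i; rewrite (ger0_norm (x := v i - u i)) ?subr_ge0//.
  by rewrite ler_wpM2r ?subr_ge0// lerDl.
have := Hd n u v uv dis ud.
have : (`|c| + 1) * (\sum_(i < n) (v i - u i)) < e / 2.
  by rewrite mulrC -ltr_pdivlMr.
lra.
Qed.

(** Values at negative times are unconstrained, so the trajectory is frozen
    at time 0 there. *)
Lemma lac_continuous {V : normedModType R} (x : R -> V) :
  locally_abs_continuous x -> continuous (fun t : R => x (Num.max t 0)).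
Proof.
move=> acx t; apply/cvgrPdist_lt => e e0.
have T0 : 0 < `|t| + 2 by have := normr_ge0 t; lra.
have [d d0 Hd] := abs_continuous_on_modulus (acx _ T0) e0.
near=> s.
have st : `|t - s| < Num.min d 1.
  by near: s; apply: cvgr_dist_lt => //; rewrite lt_min d0 ltr01.
move: st; rewrite lt_min => /andP[sd s1].
have tT : Num.max t 0 <= `|t| + 2.
  by rewrite ge_max; have := ler_norm t; have := normr_ge0 t => *; apply/andP; split; lra.
have sT : Num.max s 0 <= `|t| + 2.
  rewrite ge_max; have := ler_norm t; have := normr_ge0 t.
  by have := ler_norm (s - t); rewrite distrC => *; apply/andP; split; lra.
have ms a : 0 <= Num.max a (0 : R) by rewrite le_max lexx orbT.
have mono (u v : R) : u <= v -> Num.max u 0 <= Num.max v 0.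
  by move=> uv; rewrite !maxEle; case: ifPn; case: ifPn; rewrite -?ltNge => *; lra.
have dist (u v : R) : u <= v -> Num.max v 0 - Num.max u 0 <= v - u.
  by move=> uv; rewrite !maxEle; case: ifPn; case: ifPn; rewrite -?ltNge => *; lra.
have [ts|/ltW ts] := leP t s.
  rewrite distrC; apply: Hd => //; first exact: mono.
  apply: le_lt_trans (dist _ _ ts) _; rewrite distrC in sd.
  exact: le_lt_trans (ler_norm _) sd.
apply: Hd => //; first exact: mono.
apply: le_lt_trans (dist _ _ ts) _.
exact: le_lt_trans (ler_norm _) sd.
Unshelve. all: by end_near. Qed.

(** On [0, T] the trajectory is bounded, and u |-> u^2 / 2 is Lipschitz on
    bounded sets. *)
Lemma abs_continuous_on_sqr_dist {V : normedModType R} (x : R -> V) z T :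
  0 < T -> locally_abs_continuous x ->
  abs_continuous_on 0 T (fun t => `|x t - z| ^+ 2 / 2).
Proof.
move=> T0 acx e e0.
pose g (t : R) := `|x (Num.max t 0) - z|.
have cg : continuous g.
  move=> t; apply: cvg_norm; apply: cvgB; last exact: cvg_cst.
  exact: lac_continuous.
have [c _ Hc] := EVT_max (ltW T0) (continuous_subspaceT cg).
have gE t : 0 <= t -> g t = `|x t - z| by move=> t0; rewrite /g max_l.
pose M := g c + 1.
have M0 : 0 < M by rewrite ltr_wpDl// normr_ge0.
have gM t : 0 <= t <= T -> `|x t - z| <= M.
  move=> /andP[t0 tT]; rewrite -gE//; apply: (@le_trans _ _ (g c)).
    by apply: Hc; rewrite in_itv /= t0.
  by rewrite lerDl.
have [d d0 Hd] := acx _ T0 _ (divr_gt0 e0 M0).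
exists d => // n u v uv dis ud.
have := Hd n u v uv dis ud; rewrite ltr_pdivlMr// mulrC; apply: le_lt_trans.
rewrite mulr_sumr; apply: ler_sum => i _.
have [u0 uv' vT] := uv i.
have hu := gM _ (introT andP (conj u0 (le_trans uv' vT))).
have hv := gM _ (introT andP (conj (le_trans u0 uv') vT)).
have -> : `|x (v i) - z| ^+ 2 / 2 - `|x (u i) - z| ^+ 2 / 2 =
   (`|x (v i) - z| + `|x (u i) - z|) / 2 * (`|x (v i) - z| - `|x (u i) - z|) by field.
rewrite normrM ler_pM ?normr_ge0//.
  by rewrite ger0_norm; [lra|rewrite divr_ge0// addr_ge0].
apply: le_trans (ler_dist_dist _ _) _.
by rewrite opprB addrA subrK.
Qed.

(** [ac_comparison] with L the primitive of q, whose derivative is q almost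
    everywhere by the Lebesgue differentiation theorem. *)
Lemma ac_le_integral (F q : R -> R) a b : 0 <= a -> a <= b ->
  abs_continuous_on a b F -> (forall t, 0 <= q t) ->
  mu.-integrable setT (EFin \o q) ->
  {ae mu, forall t, a < t <= b -> forall e, 0 < e ->
     \forall s \near t^'-, F t - F s <= (q t + e) * (t - s)} ->
  F b - F a <= \int[mu]_(t in `[0, b]) q t - \int[mu]_(t in `[0, a]) q t.
Proof.
move=> a0 ab acF q0 intq aeF.
pose L t := \int[mu]_(u in `[0, t]) q u.
have intL t : mu.-integrable `[0, t] (EFin \o q).
  by apply: integrableS intq => //.
apply: (@ac_comparison _ F L a b) => //.
  move=> s t _ st _; apply: fine_le.
  - exact: integrable_fin_num.
  - exact: integrable_fin_num.
  - apply: ge0_subset_integral => //=.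
    + by have /integrableP[] := intL t.
    + by move=> u _; rewrite lee_fin.
    + by move=> u /=; rewrite ?in_itv /= => /andP[-> /le_trans->].
have locq : locally_integrable setT q by apply: open_integrable_locally; [exact: openT|].
have FTC := @FTC1 _ q (BLeft 0) intL locq.
apply: filterS2 aeF FTC; first exact: (ae_filter_ringOfSetsType mu).
move=> t /= aeFt FTCt tab e e0.
have t0 : 0 < t by case/andP: tab => h _; exact: le_lt_trans h.
have [|dL LE] := FTCt; first by rewrite lte_fin.
have e2 : 0 < e / 2 by lra.
near=> s.
have st : s < t by near: s; exact: nbhs_left_lt.
have h1 : F t - F s <= (q t + e / 2) * (t - s) by near: s; exact: aeFt.
have h2 : `|L t - L s - (t - s) *: L^`()%classic t| <= e / 2 * (t - s).
  by near: s; exact: derivable_left_increment.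
move: h2; rewrite LE /GRing.scale /= => h2.
have := ler_norm (- (L t - L s - (t - s) * q t)); rewrite normrN; lra.
Unshelve. all: by end_near. Qed.

End AC.

(** * Energy and distances along a trajectory *)

Section PhiInfty.
Context {R : realType} {H : completeNormedModType R} (phi : R -> H -> \bar R).

Lemma phi_infty_le t y : 0 <= t -> (phi_infty phi y <= phi t y)%E.
Proof.
move=> t0; apply: ge_ereal_sup => _ [g [_ gle] <-].
apply: le_trans (gle y) _; apply: ereal_inf_lbound; exists t => //=.
by rewrite in_itv /= t0.
Qed.

Lemma einf_phi_infty_le t y : 0 <= t -> (einf (phi_infty phi) <= phi t y)%E.
Proof.
by move=> t0; apply: le_trans (phi_infty_le y t0); apply: ereal_inf_lbound; exists y.
Qed.

(** Constants are lower semicontinuous, so a constant below all the phi_t is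
    below their regularized infimum: regularization does not change the infimum. *)
Lemma le_einf_phi_infty c : (forall t y, 0 <= t -> (c <= phi t y)%E) ->
  (c <= einf (phi_infty phi))%E.
Proof.
move=> cphi; apply: le_ereal_inf_tmp => _ [y _ <-]; apply: ereal_sup_ubound.
exists (fun=> c) => //; split.
  by move=> z a ac; exists setT => //; exact: filterT.
move=> z; apply: le_ereal_inf_tmp => _ [t + <-].
by rewrite /= in_itv /= andbT; exact: cphi.
Qed.

End PhiInfty.

(** Monotonicity is only known on [0, +oo[, so the function is frozen at time
    0 for negative times before the monotone convergence theorem is applied. *)
Lemma nonincreasing_cvge_pinfty {R : realType} (f : R -> \bar R) l :
  (forall s t, 0 <= s -> s <= t -> (f t <= f s)%E) ->
  (forall t, 0 <= t -> (l <= f t)%E) ->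
  (forall c, (l < c)%E -> exists2 t, 0 <= t & (f t < c)%E) ->
  f t @[t --> +oo] --> l.
Proof.
move=> fmono lf fl.
pose g (t : R) := (- f (Num.max t 0%R))%E.
have m0 (t : R) : 0 <= Num.max t 0 by rewrite le_max lexx orbT.
have gmono : {homo g : n m / n <= m >-> (n <= m)%E}.
  move=> s t st; rewrite leeN2; apply: fmono => //.
  by rewrite !maxEle; case: ifPn; case: ifPn; rewrite -?ltNge => *; lra.
have supg : ereal_sup (range g) = (- l)%E.
  apply/eqP; rewrite eq_le; apply/andP; split.
    by apply: ge_ereal_sup => _ [t _ <-]; rewrite leeN2 lf.
  rewrite leeNl; rewrite leNgt; apply/negP => /fl[t t0 ft].
  move: ft; apply/negP; rewrite -leNgt leeNl; apply: ereal_sup_ubound; exists t => //.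
  by rewrite /g max_l.
have gl : (- g t)%E @[t --> +oo] --> l.
  by rewrite -(oppeK l) -supg; apply: cvgeN; exact: nondecreasing_cvge.
apply: (cvg_trans _ gl).
apply: near_eq_cvg; near=> t.
have t0 : 0 <= t by near: t; exact: nbhs_pinfty_ge.
by rewrite /g /= oppeK max_l.
Unshelve. all: by end_near. Qed.

Lemma monotone_bounded_cvg {R : realType} (f : R -> R) (l : R) :
  (forall s t, 0 <= s -> s <= t -> f t <= f s) ->
  (forall t, 0 <= t -> l <= f t) -> exists k : R, f t @[t --> +oo] --> k.
Proof.
move=> fmono lf; pose g (t : R) := - f (Num.max t 0).
have m0 (t : R) : 0 <= Num.max t 0 by rewrite le_max lexx orbT.
have gmono : {homo g : n m / n <= m}.
  move=> s t st; rewrite lerN2; apply: fmono => //.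
  by rewrite !maxEle; case: ifPn; case: ifPn; rewrite -?ltNge => *; lra.
exists (- sup (range g)).
have gl : - g t @[t --> +oo] --> - sup (range g).
  apply: cvgN; apply: nondecreasing_cvgr => //.
  by exists (- l) => _ [t _ <-]; rewrite lerN2 lf.
apply: (cvg_trans _ gl).
apply: near_eq_cvg; near=> t.
have t0 : 0 <= t by near: t; exact: nbhs_pinfty_ge.
by rewrite /g /= opprK max_l.
Unshelve. all: by end_near. Qed.

(** For functions that need not be measurable, the integral is the supremum of
    the integrals of the simple functions below, hence still monotone.  This is
    needed because t |-> G_{d phi_t}(z, 0) comes without any measurability. *)
Lemma ge0_le_lower_integral {d} {T : measurableType d} {R : realType}
    (mu : {measure set T -> \bar R}) (D E : set T) (f g : T -> \bar R) :
  (forall t, D t -> (0 <= f t)%E) -> (forall t, E t -> (0 <= g t)%E) ->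
  (forall t, ((f \_ D) t <= (g \_ E) t)%E) ->
  (\int[mu]_(t in D) f t <= \int[mu]_(t in E) g t)%E.
Proof.
move=> f0 g0 fg; rewrite !ge0_integralE//; apply: ereal_sup_le => _ [k kf <-].
by exists k => // t; apply: le_trans (fg t).
Qed.

Section Slopes.
Context {R : realType} {H : completeNormedModType R} (ip : {dot H for idfun}).
Hypothesis ip_norm : forall u : H, ip u u = `|u| ^+ 2.

Lemma derivable_ip_increment (x : R -> H) t w : derivable x t 1 ->
  forall e, 0 < e -> \forall s \near t^'-,
    `|ip w (x t - x s) - (t - s) * ip w (x^`()%classic t)| <= e * (t - s).
Proof.
move=> dx e e0; have w0 : 0 < `|w| + 1 by rewrite ltr_wpDl.
near=> s.
have st : s < t by near: s; exact: nbhs_left_lt.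
have : `|x t - x s - (t - s) *: x^`()%classic t| <= e / (`|w| + 1) * (t - s).
  by near: s; apply: derivable_left_increment => //; exact: divr_gt0.
set r := (X in `|X|) => rle.
rewrite -ipZr -ipBr; apply: le_trans (ip_cauchy_schwarz ip_norm _ _) _.
apply: (@le_trans _ _ ((`|w| + 1) * `|r|)); first by rewrite ler_wpM2r// lerDl.
by rewrite mulrC -ler_pdivlMr// mulrAC.
Unshelve. all: by end_near. Qed.

(** Convexity of |.|^2 / 2 gives
    |a|^2 / 2 - |b|^2 / 2 <= <a, a - b> with a = x t - z and b = x s - z. *)
Lemma sqr_dist_slope (x : R -> H) t z : derivable x t 1 ->
  forall e, 0 < e -> \forall s \near t^'-,
    `|x t - z| ^+ 2 / 2 - `|x s - z| ^+ 2 / 2 <=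
      (ip (x^`()%classic t) (x t - z) + e) * (t - s).
Proof.
move=> dx e e0; near=> s.
have : `|ip (x t - z) (x t - x s) - (t - s) * ip (x t - z) (x^`()%classic t)|
    <= e * (t - s).
  by near: s; exact: derivable_ip_increment.
have -> : x t - x s = (x t - z) - (x s - z) by rewrite opprB addrA subrK.
set a := x t - z; set b := x s - z => h.
have := le_trans (ler_norm _) h; rewrite ipBr ip_norm (ipC _ (x^`()%classic t)).
have := sqr_ge0 `|a - b|; rewrite (sqr_normB ip_norm); lra.
Unshelve. all: by end_near. Qed.

End Slopes.

Section Solution.
Context {R : realType} {H : completeNormedModType R} (ip : {dot H for idfun}).
Notation mu := (@lebesgue_measure R).
Hypothesis ip_norm : forall u : H, ip u u = `|u| ^+ 2.
Variable phi : R -> H -> \bar R.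
Hypothesis phi_mono : forall s t : R, 0 <= s -> s <= t ->
  forall y : H, (phi t y <= phi s y)%E.
Variable x : R -> H.
Hypothesis x_sol : strong_global_solution ip phi x.
Hypothesis phix_fin : forall t : R, 0 <= t -> phi t (x t) \is a fin_num.
Let h t := fine (phi t (x t)).
Hypothesis phix_ac : locally_abs_continuous h.

Let hE t : 0 <= t -> phi t (x t) = (h t)%:E.
Proof. by move=> t0; rewrite fineK// phix_fin. Qed.

Lemma ae_velocity_subgradient : {ae mu, forall t, 0 < t ->
  derivable x t 1 /\ subdifferential ip (phi t) (x t) (- x^`()%classic t)}.
Proof.
have [_] := x_sol; apply: filterS; first exact: (ae_filter_ringOfSetsType mu).
move=> t xt t0; have [dx [p px /eqP]] := xt t0.
by rewrite addrC addr_eq0 => /eqP <-.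
Qed.

(** The subgradient inequality at time t is read at x s, where
    phi t (x s) <= phi s (x s).  This works only for s < t. *)
Lemma energy_slope t : 0 < t -> derivable x t 1 ->
  subdifferential ip (phi t) (x t) (- x^`()%classic t) ->
  forall e, 0 < e -> \forall s \near t^'-,
    h t - h s <= (- `|x^`()%classic t| ^+ 2 + e) * (t - s).
Proof.
move=> t0 dx [_ sub] e e0; near=> s.
have st : s < t by near: s; exact: nbhs_left_lt.
have s0 : 0 <= s by near: s; exact: nbhs_left_ge.
have : `|ip (x^`()%classic t) (x t - x s) -
    (t - s) * ip (x^`()%classic t) (x^`()%classic t)| <= e * (t - s).
  by near: s; exact: derivable_ip_increment.
have := le_trans (sub (x s)) (phi_mono s0 (ltW st) (x s)).
rewrite !hE ?(ltW t0)// -EFinD lee_fin ip_norm ipNl -(opprB (x t) (x s)) ipNr opprK.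
by rewrite ler_norml => h1 /andP[h2 _]; lra.
Unshelve. all: by end_near. Qed.

Lemma energy_nonincreasing s t : 0 <= s -> s <= t -> h t <= h s.
Proof.
move=> s0 st; have [t0|t0] := eqVneq t 0.
  by rewrite (_ : s = t)//; apply/eqP; rewrite eq_le st t0.
have {}t0 : 0 < t by rewrite lt_neqAle eq_sym t0 (le_trans s0 st).
rewrite -subr_le0 -(subrr (0 : R)).
apply: (@ac_comparison _ h (fun=> 0)) => //.
  by apply: abs_continuous_onS (phix_ac t0).
apply: filterS ae_velocity_subgradient.
  exact: (ae_filter_ringOfSetsType mu).
move=> r reg /andP[sr _] e e0; have r0 := le_lt_trans s0 sr.
have [dx sub] := reg r0.
near=> u; have : h r - h u <= (- `|x^`()%classic r| ^+ 2 + e) * (r - u).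
  by near: u; exact: energy_slope.
have : u < r by near: u; exact: nbhs_left_lt.
have := sqr_ge0 `|x^`()%classic r|; nra.
Unshelve. all: by end_near. Qed.

(** Otherwise h >= c > phi T y forever, and the subgradient inequality read
    at y gives |x t - y|^2 / 2 a slope at most phi T y - c after T. *)
Lemma energy_lt_value T y (c : R) : 0 <= T -> (-oo < phi T y)%E ->
  (phi T y < c%:E)%E -> exists2 t, 0 <= t & h t < c.
Proof.
move=> T0; case phiT: (phi T y) => [Y| |]// _; rewrite lte_fin => Yc.
apply: contrapT => nex.
have hc t : 0 <= t -> c <= h t.
  by move=> t0; rewrite leNgt; apply/negP => htc; apply: nex; exists t.
pose th t := `|x t - y| ^+ 2 / 2; pose k := c - Y.
have k0 : 0 < k by rewrite /k; lra.
have th0 t : 0 <= th t by rewrite divr_ge0// sqr_ge0.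
(* A function that starts at th T and decreases at rate k is negative at b. *)
pose b := T + th T / k + 1.
have Tb : T < b by have := divr_ge0 (th0 T) (ltW k0); rewrite /b; lra.
have b0 := le_lt_trans T0 Tb.
suff : (th b + k * b) - (th T + k * T) <= 0 - 0.
  have -> : th b + k * b - (th T + k * T) = th b + k.
    by rewrite /b; field; rewrite gt_eqF.
  by have := th0 b; lra.
apply: (@ac_comparison _ (fun t => th t + k * t) (fun=> 0)) => //; first exact: ltW.
  apply: abs_continuous_onDlin; apply: abs_continuous_onS T0 (lexx b) _.
  by apply: abs_continuous_on_sqr_dist => //; have [] := x_sol.
apply: filterS ae_velocity_subgradient.
  exact: (ae_filter_ringOfSetsType mu).
move=> r reg /andP[sr _] e e0; have r0 := le_lt_trans T0 sr.
have [dx [_ sub]] := reg r0.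
near=> s; have : th r - th s <= (ip (x^`()%classic r) (x r - y) + e) * (r - s).
  by near: s; exact: sqr_dist_slope.
have sr' : s < r by near: s; exact: nbhs_left_lt.
have := le_trans (sub y) (phi_mono T0 (ltW sr) y).
rewrite phiT hE ?(ltW r0)// -EFinD lee_fin ipNl -(opprB (x r) y) ipNr opprK => hr.
have := hc _ (ltW r0).
rewrite /k; nra.
Unshelve. all: by end_near. Qed.

Lemma energy_cvg : (forall t, 0 <= t -> forall y, (-oo < phi t y)%E) ->
  phi t (x t) @[t --> +oo] --> einf (phi_infty phi).
Proof.
move=> phiNy; apply: nonincreasing_cvge_pinfty.
- move=> s t s0 st; rewrite !hE ?(le_trans s0 st)// lee_fin.
  exact: energy_nonincreasing.
- by move=> t t0; exact: einf_phi_infty_le.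
- move=> c lc.
  have [[T y] /= [T0 Tc]] : exists Ty : R * H, 0 <= Ty.1 /\ (phi Ty.1 Ty.2 < c)%E.
    apply: contrapT => /forallNP hc.
    move: lc; apply/negP; rewrite -leNgt.
    apply: le_einf_phi_infty => t y t0; rewrite leNgt; apply/negP => tc.
    exact: (hc (t, y)).
  case phiT : (phi T y) (phiNy _ T0 y) Tc => [Y| |]// _ Yc; last by move: Yc; rewrite ltNge leey.
  have [c' Yc' cc] : exists2 c' : R, Y < c' & (c'%:E <= c)%E.
    case: c {lc} Yc => [c| |]// Yc; first by exists c.
    by exists (Y + 1); [rewrite ltrDl|rewrite leey].
  have [||t t0 htc] := @energy_lt_value T y c' T0.
  - by rewrite phiT ltNyr.
  - by rewrite phiT lte_fin.
  by exists t => //; rewrite hE//; apply: lt_le_trans cc; rewrite lte_fin.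
Qed.

Import HBNNSimple.

(** The comparison theorem needs a nonnegative upper slope, so
    h t + M t, whose slope is at most M - g, is compared with the integral of
    M - g. *)
Lemma simple_dissipation_le (g : measurableTypeR R -> R) (M T : R) : 0 < T ->
  measurable_fun setT g -> (forall t, 0 <= g t <= M) ->
  (forall t, 0 <= t -> g t <= `|x^`()%classic t| ^+ 2) ->
  (\int[mu]_(t in `[0%R, T]) (g t)%:E <= (h 0 - h T)%:E)%E.
Proof.
move=> T0 mg g0M gx.
have muI : mu `[0, T] = T%:E.
  by rewrite lebesgue_measure_itv /= lte_fin T0 oppr0 adde0.
have muIoo : (mu `[0%R, T] < +oo)%E by rewrite muI ltry.
have intg : mu.-integrable `[0, T] (EFin \o g).
  apply: measurable_bounded_integrable => //; first exact: measurable_funTS.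
  exists M; split; first by rewrite num_real.
  move=> r Mr t _ /=; have /andP[gt0 gtM] := g0M t.
  by rewrite ger0_norm// (le_trans gtM)// ltW.
have intM : mu.-integrable `[0, T] (EFin \o cst M).
  apply: measurable_bounded_integrable => //.
  by exists `|M|; split; [rewrite num_real|move=> r Mr t _ /=; rewrite ltW].
pose q := (fun t => M - g t) \_ `[0, T].
have qE : {in `[0, T]%classic, q =1 (fun t => M - g t)}.
  by move=> t tI; rewrite /q patchE tI.
have q0 t : 0 <= q t.
  rewrite /q patchE; case: ifP => // _; rewrite subr_ge0.
  by have /andP[] := g0M t.
have intq : mu.-integrable setT (EFin \o q).
  rewrite /q -restrict_EFin; apply/integrable_restrict => //.
  rewrite setTI; exact: (integrableB _ intM intg).
rewrite -(fineK (integrable_fin_num _ intg))// lee_fin.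
have : (h T + M * T) - (h 0 + M * 0) <=
    \int[mu]_(t in `[0, T]) q t - \int[mu]_(t in `[0, 0]) q t.
  apply: (@ac_le_integral _ (fun t => h t + M * t)) => //; first exact: ltW.
    apply: abs_continuous_onDlin; exact: phix_ac.
  apply: filterS ae_velocity_subgradient.
    exact: (ae_filter_ringOfSetsType mu).
  move=> t reg tT e e0; have /andP[t0 tT'] := tT; have [dx sub] := reg t0.
  rewrite qE; last by rewrite inE /= in_itv /= (ltW t0).
  near=> s.
  have : h t - h s <= (- `|x^`()%classic t| ^+ 2 + e) * (t - s).
    by near: s; exact: energy_slope.
  have : s < t by near: s; exact: nbhs_left_lt.
  have := gx t (ltW t0); nra.
have -> : \int[mu]_(t in `[0, T]) q t = M * T - \int[mu]_(t in `[0, T]) g t.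
  transitivity (\int[mu]_(t in `[0, T]) (M - g t)).
    by apply: eq_Rintegral; exact: qE.
  by rewrite RintegralB// Rintegral_cst//=; move: muI => /= ->.
by rewrite set_itv1 Rintegral_set1 subr0 mulr0 addr0 /Rintegral; lra.
Unshelve. all: by end_near. Qed.

(** The integral of |x'|^2 is a supremum of integrals of simple functions
    below it, and each of these is bounded by the loss of energy. *)
Lemma finite_dissipation m : (forall t, 0 <= t -> m <= h t) ->
  (\int[mu]_(t in `[0%R, +oo[) (`|x^`()%classic t| ^+ 2)%R%:E <= (h 0 - m)%:E)%E.
Proof.
move=> mh; rewrite ge0_integralE; last by move=> t _; rewrite lee_fin sqr_ge0.
apply: ge_ereal_sup => _ [g /= gle <-].
have gx t : 0 <= t -> g t <= `|x^`()%classic t| ^+ 2.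
  move=> t0; have := gle t; rewrite patchE mem_set ?lee_fin//=.
  by rewrite in_itv /= t0.
have gN t : t < 0 -> g t = 0.
  move=> t0; have := gle t; rewrite patchE memNset ?lee_fin//=.
    by move=> g0; apply/eqP; rewrite eq_le g0 fun_ge0.
  by rewrite in_itv /= leNgt t0.
have [M gM] : exists M, forall t, g t <= M.
  have [M [_ HM]] := simple_bounded g.
  exists (M + 1) => t; apply: le_trans (ler_norm _) _.
  by apply: HM => //; rewrite ltrDl.
rewrite -integralT_nnsfun.
have -> : (\int[mu]_t (g t)%:E)%E = (\int[mu]_(t in `[0%R, +oo[) (g t)%:E)%E.
  rewrite [RHS]integral_mkcond; apply: eq_integral => t _.
  rewrite patchE; case: ifPn => //; rewrite notin_setE /= in_itv /= andbT => /negP.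
  by rewrite -ltNge => /gN ->.
rewrite (itv_bndy_bigcup_BRight true 0).
have cvgg : (\int[mu]_(t in `[0%R, (0 + n%:R)%R]) (g t)%:E)%E @[n --> \oo] -->
    (\int[mu]_(t in \bigcup_n `[0%R, (0 + n%:R)%R]%classic) (g t)%:E)%E.
  apply: ge0_nondecreasing_set_cvg_integral.
  - move=> n k nk; apply/subsetPset => t /=; rewrite ?in_itv /= => /andP[-> /le_trans->]//.
    by rewrite lerD2l ler_nat.
  - by move=> n; exact: measurable_itv.
  - move=> n; apply/measurable_EFinP; exact: measurable_funTS.
  - by move=> n t _; rewrite lee_fin fun_ge0.
rewrite -(cvg_lim (@ereal_hausdorff R) cvgg); apply: lime_le.
  by apply/cvg_ex; eexists; exact: cvgg.
near=> n; rewrite add0r.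
have n0 : 0 < n%:R :> R by rewrite ltr0n; near: n; exact: nbhs_infty_gt.
apply: (@le_trans _ _ (h 0 - h n%:R)%:E).
  apply: (@simple_dissipation_le g M) => //.
  by move=> t; rewrite fun_ge0 gM.
by rewrite lee_fin lerD2l lerN2 mh// ltW.
Unshelve. all: by end_near. Qed.

(** On D, the function is the pointwise limit of the continuous functions
    obtained by replacing the derivative by difference quotients of step
    1 / (n + 1). *)
Lemma measurable_ip_velocity (D : set (measurableTypeR R)) z :
  measurable D -> (forall t, D t -> 0 < t /\ derivable x t 1) ->
  measurable_fun D (fun t => ip (x^`()%classic t) (x t - z)).
Proof.
move=> mD Dt.
pose xx (t : R) := x (Num.max t 0).
have cxx : continuous xx by apply: lac_continuous; have [] := x_sol.
have cip (f g : R -> H) : continuous f -> continuous g ->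
    continuous (fun t => ip (f t) (g t)).
  move=> cf cg.
  have -> : (fun t => ip (f t) (g t)) =
      (fun t => (`|f t + g t| * `|f t + g t| - `|f t| * `|f t| - `|g t| * `|g t|) / 2).
    apply/funext => t; rewrite -!expr2 (sqr_normD ip_norm).
    by field.
  move=> t; apply: cvgM; last exact: cvg_cst.
  have cn (k : R -> H) : continuous k -> `|k s| * `|k s| @[s --> t] --> `|k t| * `|k t|.
    by move=> ck; apply: cvgM; apply: cvg_norm; exact: ck.
  apply: cvgB; last exact: cn.
  apply: cvgB; last exact: cn.
  by apply: (cn (fun s => f s + g s)) => s; apply: cvgD; [exact: cf|exact: cg].
pose dn (n : nat) : R := n.+1%:R^-1.
pose F n (t : R) := n.+1%:R * ip (xx t - xx (t - dn n)) (xx t - z).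
apply: (@measurable_fun_cvg _ _ R D F) => //.
  move=> n; apply: measurable_funTS; apply: continuous_measurable_fun => t.
  apply: cvgM; first exact: cvg_cst.
  apply: (cip (fun t => xx t - xx (t - dn n)) (fun t => xx t - z)) => s.
    apply: cvgB; first exact: cxx.
    apply: (@continuous_comp _ _ _ (fun t => t - dn n) xx); last exact: cxx.
    by apply: cvgB; [exact: cvg_id|exact: cvg_cst].
  by apply: cvgB; [exact: cxx|exact: cvg_cst].
move=> t /Dt[t0 dx]; apply/cvgrPdist_le => e e0.
have inc := derivable_ip_increment ip_norm (x t - z) dx e0.
move: inc => /nbhs_ballP[d /= d0 Hd].
near=> n.
have dn0 : 0 < dn n by rewrite invr_gt0.
have dnd : dn n < d.
  by near: n; exact: (near_infty_natSinv_lt (PosNum d0)).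
have dnt : dn n < t.
  by near: n; exact: (near_infty_natSinv_lt (PosNum t0)).
have /= := Hd (t - dn n); rewrite /ball /= opprB addrC subrK gtr0_norm// => /(_ dnd).
rewrite ltrBlDr ltrDl => /(_ dn0) He.
rewrite /F /xx !max_l ?subr_ge0 ?(ltW t0) ?(ltW dnt)//.
rewrite (ipC _ (x^`()%classic t)) (ipC ip (x t - x _)).
have -> : ip (x t - z) (x^`()%classic t) - n.+1%:R * ip (x t - z) (x t - x (t - dn n)) =
   - (n.+1%:R * (ip (x t - z) (x t - x (t - dn n)) - dn n * ip (x t - z) (x^`()%classic t))).
  by rewrite mulrBr mulrA /dn mulfV ?pnatr_eq0// mul1r opprB.
rewrite normrN normrM (ger0_norm (x := n.+1%:R))//.
apply: (@le_trans _ _ (n.+1%:R * (e * dn n))).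
  by rewrite ler_wpM2l.
by rewrite mulrCA /dn mulfV ?pnatr_eq0// mulr1.
Unshelve. all: by end_near. Qed.

(** Let q be the positive part of the derivative of |x t - z|^2 / 2 off a null
    set, and L its primitive, which is bounded because q is below the
    Brezis-Haraux function.  By comparison |x t - z|^2 / 2 - L t is nonincreasing
    and bounded below; as L also converges, so does their sum. *)
Lemma sqr_dist_cvg z :
  (forall t, 0 <= t -> (0%E <= brezis_haraux ip (subdifferential ip (phi t)) z 0%R)%E) ->
  (\int[mu]_(t in `[0%R, +oo[)
     brezis_haraux ip (subdifferential ip (phi t)) z 0%R < +oo)%E ->
  exists k : R, `|x t - z| ^+ 2 / 2 @[t --> +oo] --> k.
Proof.
set G := fun t => brezis_haraux ip (subdifferential ip (phi t)) z 0%R => G0 intG.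
have [A [mA A0 sub]] := ae_velocity_subgradient.
pose D : set (measurableTypeR R) := `]0, +oo[ `\` A.
have mD : measurable D by apply: measurableD => //; exact: measurable_itv.
have regD t : D t -> [/\ 0 < t, derivable x t 1 &
    subdifferential ip (phi t) (x t) (- x^`()%classic t)].
  move=> [/=]; rewrite in_itv /= andbT => t0 nA.
  have : ~ ~ (0 < t -> derivable x t 1 /\
     subdifferential ip (phi t) (x t) (- x^`()%classic t)).
    by move=> ntP; apply: nA; apply: sub.
  by move=> /contrapT/(_ t0)[].
pose w t := ip (x^`()%classic t) (x t - z).
pose q := (fun t : measurableTypeR R => Num.max (w t) 0) \_ D.
have q0 t : 0 <= q t by rewrite /q patchE; case: ifP => // _; rewrite le_max lexx orbT.
have wG t : D t -> ((w t)%:E <= G t)%E.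
  move=> /regD[t0 dx st]; apply: ereal_sup_ubound.
  exists (x t, - x^`()%classic t) => //=.
  by rewrite subr0 -(opprB (x t) z) ipNl ipNr opprK ipC.
have mq : measurable_fun setT q.
  have mw : measurable_fun D w.
    by apply: measurable_ip_velocity => // t /regD[].
  apply/(measurable_restrictT _ mD).
  exact: (measurable_maxr mw (measurable_cst _)).
have intq : mu.-integrable setT (EFin \o q).
  apply/integrableP; split; first exact/measurable_EFinP.
  apply: le_lt_trans intG; apply: ge0_le_lower_integral => //.
    by move=> t /=; rewrite in_itv /= andbT; exact: G0.
  move=> t; rewrite patch_setT /= ger0_norm//.
  rewrite /q !patchE; case: ifPn => tD.
    rewrite mem_set; last first.
      by have [t0 _ _] := regD _ (set_mem tD); rewrite /= in_itv /= ltW.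
    have [t0 _ _] := regD _ (set_mem tD).
    case: (leP (w t) 0) => _; first by rewrite G0// ltW.
    exact: wG (set_mem tD).
  case: ifPn => // /set_mem /=; rewrite in_itv /= andbT; exact: G0.
pose th t := `|x t - z| ^+ 2 / 2.
pose L t := \int[mu]_(s in `[0, t]) q s.
have thL a b : 0 <= a -> a <= b -> th b - th a <= L b - L a.
  move=> a0 ab; have [b0|b0] := eqVneq b 0.
    have -> : a = b by apply/eqP; rewrite eq_le ab b0.
    by rewrite !subrr.
  have {}b0 : 0 < b by rewrite lt_neqAle eq_sym b0 (le_trans a0 ab).
  apply: ac_le_integral => //.
    apply: abs_continuous_onS a0 (lexx b) _.
    by apply: abs_continuous_on_sqr_dist => //; have [] := x_sol.
  exists A; split => // t /= nP; apply: contrapT => nA; apply: nP => tab e e0.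
  have t0 : 0 < t by case/andP: tab => lt_at _; exact: le_lt_trans lt_at.
  have tD : D t by split => //=; rewrite in_itv /= t0.
  have [_ dx _] := regD t tD.
  near=> s.
  have : th t - th s <= (w t + e) * (t - s).
    by near: s; exact: sqr_dist_slope.
  have : s < t by near: s; exact: nbhs_left_lt.
  have : w t <= q t by rewrite /q patchE mem_set// le_max lexx.
  rewrite -subr_gt0 => wq st /le_trans; apply.
  by rewrite ler_pM2r// lerD2r.
pose K := fine (\int[mu]_t (q t)%:E).
have LK t : 0 <= t -> L t <= K.
  move=> t0; apply: fine_le.
  - by apply: integrable_fin_num => //; apply: integrableS intq.
  - exact: integrable_fin_num.
  - by apply: ge0_subset_integral => // [|s _]; [have /integrableP[] := intq|rewrite lee_fin].
have Lmono s t : 0 <= s -> s <= t -> L s <= L t.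
  move=> s0 st; apply: fine_le.
  - by apply: integrable_fin_num => //; apply: integrableS intq.
  - by apply: integrable_fin_num => //; apply: integrableS intq.
  - apply: ge0_subset_integral => //=.
    + apply: measurable_funTS; by have /integrableP[] := intq.
    + by move=> u _; rewrite lee_fin.
    + by move=> u /=; rewrite ?in_itv /= => /andP[-> /le_trans->].
have [k1 k1P] : exists k : R, (th t - L t) @[t --> +oo] --> k.
  apply: (@monotone_bounded_cvg _ _ (- K)) => [s t s0 st|t t0].
    by have := thL s t s0 st; lra.
  have : 0 <= th t by rewrite divr_ge0// sqr_ge0.
  by have := LK t t0; lra.
have [k2 k2P] : exists k : R, (- L t) @[t --> +oo] --> k.
  apply: (@monotone_bounded_cvg _ _ (- K)) => [s t s0 st|t t0].
    by rewrite lerN2; exact: Lmono.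
  by rewrite lerN2; exact: LK.
exists (k1 - k2).
rewrite (_ : (fun t => _) = (fun t => th t - L t - (- L t))).
  exact: cvgB k1P k2P.
by apply/funext => t; rewrite opprK subrK.
Unshelve. all: by end_near. Qed.

End Solution.

(** * Weak convergence *)

Lemma near_pinftyP {R : realType} (P : set R) :
  (\forall t \near +oo, P t) <-> exists T, forall t, T <= t -> P t.
Proof.
split=> [[M [_ HM]]|[T HT]].
  by exists (M + 1) => t Mt; apply: HM; rewrite (lt_le_trans _ Mt)// ltrDl.
by near=> t; apply: HT; near: t; apply: nbhs_pinfty_ge; exact: num_real.
Unshelve. all: by end_near. Qed.

Section Opial.
Context {R : realType} {H : completeNormedModType R} (ip : {dot H for idfun}).
Hypothesis ip_norm : forall u : H, ip u u = `|u| ^+ 2.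
Variable x : R -> H.

(** The closure of a midpoint convex set is closed and convex, so p is required
    to lie in every closed convex set that contains the trajectory at all large
    times of P, as the weak limits of subsequences along P do. *)
Definition weak_cluster_along (P : set R) (p : H) := forall C : set H,
  midconvex C -> (exists T, forall t, T <= t -> P t -> C (x t)) -> closure C p.

Lemma weak_cluster_along_exists (P : set R) (r T0 : R) :
  (forall T, exists2 t, T <= t & P t) ->
  (forall t, T0 <= t -> `|x t| <= r) ->
  exists p, weak_cluster_along P p.
Proof.
move=> Pub xr.
pose F : set (set H) := [set C | midconvex C /\
  exists T, forall t, T <= t -> P t -> C (x t)].
have midI C D : midconvex C -> midconvex D -> midconvex (C `&` D).
  by move=> mC mD u v [Cu Du] [Cv Dv]; split; [exact: mC|exact: mD].
have [||||p pP] := @directed_midconvex_cluster R H ip ip_norm F r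
    [set y | `|y| <= r].
- move=> A B [mA [TA HA]] [mB [TB HB]]; exists (A `&` B) => //.
  split; first exact: midI.
  exists (Num.max TA TB) => t; rewrite ge_max => /andP[tA tB] Pt.
  by split; [exact: HA|exact: HB].
- move=> A [mA [T HT]]; split=> //.
  by have [t Tt Pt] := Pub T; exists (x t); exact: HT.
- split; last by exists T0 => t Tt _; exact: xr.
  move=> u v /= ur vr; rewrite normrZ ger0_norm ?invr_ge0//.
  have := ler_normD u v; lra.
- by [].
by exists p => C mC CT; apply: pP.
Qed.

Lemma midconvex_halfspace w a : midconvex [set v | a <= ip v w].
Proof. by move=> u v /= ua va; rewrite !ipE; lra. Qed.

Lemma closure_halfspace w a p : closure [set v | a <= ip v w] p -> a <= ip p w.
Proof.
move=> clp; rewrite leNgt; apply/negP => pa.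
have w0 : 0 < `|w| + 1 by rewrite ltr_wpDl.
have e0 : 0 < (a - ip p w) / (`|w| + 1) by rewrite divr_gt0// subr_gt0.
have [v [/= av]] := clp _ (nbhsx_ballx p _ e0).
rewrite -ball_normE /= ltr_pdivlMr// => pv.
have := ip_cauchy_schwarz ip_norm (v - p) w; rewrite ipBl (distrC v) => cs.
have := le_trans (ler_norm _) cs; have := normr_ge0 (p - v); nra.
Qed.

Lemma weak_cluster_ge (P : set R) p w a : weak_cluster_along P p ->
  (exists T, forall t, T <= t -> P t -> a <= ip (x t) w) -> a <= ip p w.
Proof.
by move=> pP aT; apply: closure_halfspace; apply: pP => //; exact: midconvex_halfspace.
Qed.

(** The difference of |x t - q|^2 and |x t - p|^2 is affine in x t with
    linear part 2 <x t, p - q>.  It converges, so <x t, p - q> has a limit, and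
    both cluster points lie in all half-spaces that this limit determines:
    <p, p - q> = <q, p - q>. *)
Lemma weak_cluster_unique (P Q : set R) p q (k l : R) :
  `|x t - p| ^+ 2 / 2 @[t --> +oo] --> k ->
  `|x t - q| ^+ 2 / 2 @[t --> +oo] --> l ->
  weak_cluster_along P p -> weak_cluster_along Q q -> p = q.
Proof.
move=> pk ql pP qQ.
(* The limit of <x t, p - q>. *)
pose c := l - k + (`|p| ^+ 2 / 2 - `|q| ^+ 2 / 2).
have ip_xE t : ip (x t) (p - q) =
    `|x t - q| ^+ 2 / 2 - `|x t - p| ^+ 2 / 2 + (`|p| ^+ 2 / 2 - `|q| ^+ 2 / 2).
  by rewrite !(sqr_normB ip_norm) ipBr; lra.
have cvc : ip (x t) (p - q) @[t --> +oo] --> c.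
  rewrite (funext ip_xE); apply: cvgD; last exact: cvg_cst.
  exact: cvgB.
have bounds (S : set R) u : weak_cluster_along S u -> ip u (p - q) = c.
  move=> uS; apply/eqP; rewrite eq_le; apply/andP; split; apply/ler_addgt0Pr => e e0.
    have : - (c + e) <= ip u (- (p - q)).
      apply: (weak_cluster_ge uS).
      have /near_pinftyP[T HT] : \forall t \near +oo, ip (x t) (p - q) <= c + e.
        by apply: (cvgr_le _ cvc); rewrite ltrDl.
      by exists T => t /HT tT _; rewrite ipNr lerN2.
    by rewrite ipNr lerN2.
  have : c - e <= ip u (p - q).
    apply: (weak_cluster_ge uS).
    have /near_pinftyP[T HT] : \forall t \near +oo, c - e <= ip (x t) (p - q).
      by apply: (cvgr_ge _ cvc); rewrite ltrBlDr ltrDl.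
    by exists T => t /HT tT _.
  by rewrite lerBlDr.
apply/eqP; rewrite -subr_eq0 -normr_eq0 -sqrf_eq0 -ip_norm ipBl.
by rewrite (bounds _ _ pP) (bounds _ _ qQ) subrr.
Qed.

(** If <x t, w> exceeded <p, w> + e at arbitrarily large times, the cluster
    point along these times would lie in the half-space <., w> >= <p, w> + e,
    whereas uniqueness says that it is p. *)
Lemma opial (S : set H) : S !=set0 ->
  (forall z, S z -> exists k : R, `|x t - z| ^+ 2 / 2 @[t --> +oo] --> k) ->
  (forall P p, weak_cluster_along P p -> S p) ->
  exists2 p, S p & weak_cvg_pinfty ip x p.
Proof.
move=> [z0 Sz0] Scvg clS.
have [r [T0 xr]] : exists r T0, forall t, T0 <= t -> `|x t| <= r.
  have [k kP] := Scvg _ Sz0.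
  have /near_pinftyP[T HT] : \forall t \near +oo, `|x t - z0| ^+ 2 / 2 <= k + 1.
    by apply: (cvgr_le _ kP); rewrite ltrDl.
  exists (k + 2 + `|z0|), T => t /HT; set n := `|x t - z0| => nk.
  have : `|x t| <= n + `|z0| by rewrite -{1}(subrK z0 (x t)) ler_normD.
  by have := sqr_ge0 (n - 1); nra.
have [|p pP] := @weak_cluster_along_exists setT r T0 _ xr.
  by move=> T; exists T.
have Sp := clS _ _ pP.
exists p => // y.
have upper (w : H) (e : R) : 0 < e ->
    \forall t \near +oo, ip (x t) w <= ip p w + e.
  move=> e0; apply: contrapT => nnear.
  pose P := [set t | ip p w + e <= ip (x t) w].
  have Pub T : exists2 t, T <= t & P t.
    apply: contrapT => nex; apply: nnear; apply/near_pinftyP; exists T => t Tt.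
    rewrite leNgt; apply/negP => /ltW lt; apply: nex.
    by exists t.
  have [q qP] := weak_cluster_along_exists Pub xr.
  have [k kP] := Scvg _ Sp; have [l lP] := Scvg _ (clS _ _ qP).
  have pq := weak_cluster_unique kP lP pP qP.
  have : ip p w + e <= ip q w.
    by apply: (weak_cluster_ge qP); exists 0 => t _.
  by rewrite pq gerDl leNgt e0.
apply/cvgrPdist_le => e e0; near=> t.
have h1 : ip (x t) y <= ip p y + e by near: t; exact: upper.
have h2 : ip (x t) (- y) <= ip p (- y) + e by near: t; exact: upper.
by rewrite ler_norml; move: h2; rewrite !ipNr => h2; apply/andP; split; lra.
Unshelve. all: by end_near. Qed.

End Opial.

Section Sublevels.
Context {R : realType} {H : completeNormedModType R} (phi : R -> H -> \bar R).

(** The strict sublevel set of the infimum of the phi_t, before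
    regularization. *)
Definition union_sublevel (c : R) : set H :=
  [set y | exists2 t, 0 <= t & (phi t y < c%:E)%E].

(** A union of convex sets, nested because phi_t decreases with t. *)
Lemma midconvex_union_sublevel c :
  (forall t, 0 <= t -> closed_convex_proper (phi t)) ->
  (forall s t, 0 <= s -> s <= t -> forall y, (phi t y <= phi s y)%E) ->
  midconvex (union_sublevel c).
Proof.
move=> ccp mono u v [s s0 us] [t t0 vt].
pose T := Num.max s t.
have sT : s <= T by rewrite le_max lexx.
have tT : t <= T by rewrite le_max lexx orbT.
have T0 : 0 <= T := le_trans s0 sT.
have [_ cT [TNy _]] := ccp _ T0.
have uT := le_lt_trans (mono _ _ s0 sT u) us.
have vT := le_lt_trans (mono _ _ t0 tT v) vt.
exists T => //.
have h2 : 0 < (2^-1 : R) < 1 by apply/andP; split; lra.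
case Eu: (phi T u) uT (TNy u) => [a| |]//; rewrite lte_fin => ac _.
case Ev: (phi T v) vT (TNy v) => [b| |]//; rewrite lte_fin => bc _.
rewrite scalerDr.
have -> : 2^-1 *: v = (1 - 2^-1) *: v by congr (_ *: _); lra.
apply: (@le_lt_trans _ _ (2^-1 * a + (1 - 2^-1) * b)%:E).
  by apply: econvex_le; rewrite ?Eu ?Ev.
by rewrite lte_fin; lra.
Qed.

(** A lower semicontinuous minorant of the infimum of the phi_t that exceeded
    some c > m at p would exceed c near p, where it is below c at points of the
    sublevel set.  The closures of these sets play the role of the sublevel sets of
    phi_infty, with the advantage that their convexity is immediate. *)
Lemma closure_sublevel_argmin (m : R) p : einf (phi_infty phi) = m%:E ->
  (forall c, m < c -> closure (union_sublevel c) p) -> argmin (phi_infty phi) p.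
Proof.
move=> em clp; apply/eqP; rewrite eq_le; apply/andP; split; last first.
  by apply: ereal_inf_lbound; exists p.
rewrite em; apply: ge_ereal_sup => _ [g [lg gle] <-].
rewrite leNgt; apply/negP => mg.
have [c mc cg] : exists2 c : R, m < c & (c%:E < g p)%E.
  case: (g p) mg => [r| |]//; last by exists (m + 1); rewrite ?ltrDl ?ltry.
  by rewrite lte_fin => mr; exists ((m + r) / 2); rewrite ?lte_fin; lra.
have [V Vp Vg] := lg _ _ cg.
have [y [[t t0 yt] Vy]] := clp _ mc _ Vp.
have := lt_le_trans (Vg _ Vy) (gle y); rewrite ltNge => /negP; apply.
apply: le_trans (ltW yt); apply: ereal_inf_lbound; exists t => //=.
by rewrite in_itv /= t0.
Qed.

End Sublevels.

Theorem theorem3p1 (R : realType) (H : completeNormedModType R)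
  (ip : {dot H for idfun})
  (ip_norm : forall u : H, ip u u = `|u| ^+ 2)
  (phi : R -> H -> \bar R)
  (phi_ccp : forall t : R, 0 <= t -> closed_convex_proper (phi t))
  (phi_mono : forall s t : R, 0 <= s -> s <= t ->
     forall y : H, (phi t y <= phi s y)%E)
  (x : R -> H)
  (x_sol : strong_global_solution ip phi x)
  (phix_fin : forall t : R, 0 <= t -> phi t (x t) \is a fin_num)
  (phix_ac : locally_abs_continuous (fun t : R => fine (phi t (x t)))) :
  [/\ (forall s t : R, 0 <= s -> s <= t -> (phi t (x t) <= phi s (x s))%E) /\
      phi t (x t) @[t --> +oo] --> einf (phi_infty phi),
      (-oo < einf (phi_infty phi))%E ->
        (\int[lebesgue_measure]_(t in `[0%R, +oo[) (`|x^`()%classic t| ^+ 2)%R%:E < +oo)%E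
    & (-oo < einf (phi_infty phi))%E ->
      argmin (phi_infty phi) !=set0 ->
      (forall z : H, argmin (phi_infty phi) z ->
        (\int[lebesgue_measure]_(t in `[0%R, +oo[)
           brezis_haraux ip (subdifferential ip (phi t)) z 0%R < +oo)%E) ->
      exists2 x_infty : H, argmin (phi_infty phi) x_infty &
        weak_cvg_pinfty ip x x_infty].
Proof.
have phiNy t y : 0 <= t -> (-oo < phi t y)%E.
  by move=> t0; have [_ _ [h _]] := phi_ccp _ t0; exact: h.
have cvg_energy : phi t (x t) @[t --> +oo] --> einf (phi_infty phi).
  by apply: (energy_cvg ip_norm phi_mono x_sol phix_fin phix_ac) => t t0 y; exact: phiNy.
have einf_fin : (-oo < einf (phi_infty phi))%E ->
    exists m : R, einf (phi_infty phi) = m%:E.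
  have := einf_phi_infty_le phi (x 0) (lexx 0).
  rewrite -(fineK (phix_fin 0 (lexx 0))).
  by case: (einf _) => [m| |]// _ _; exists m.
split.
- split=> // s t s0 st; have t0 := le_trans s0 st.
  rewrite -(fineK (phix_fin _ s0)) -(fineK (phix_fin _ t0)) lee_fin.
  exact: (energy_nonincreasing ip_norm phi_mono x_sol phix_fin phix_ac s0 st).
- move=> /einf_fin[m em].
  have mh t : 0 <= t -> m <= fine (phi t (x t)).
    move=> t0; rewrite -lee_fin fineK ?phix_fin// -em.
    exact: einf_phi_infty_le.
  apply: le_lt_trans (finite_dissipation ip_norm phi_mono x_sol phix_fin phix_ac mh) _.
  exact: ltry.
- move=> /einf_fin[m em] S0 intG.
  apply: (opial ip_norm S0) => [z Sz|P p pP].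
    apply: (sqr_dist_cvg ip_norm x_sol) (intG _ Sz) => t t0.
    apply: (@brezis_haraux_ge0 _ _ _ ip_norm _ m); first exact: phi_ccp.
    by move=> y; rewrite -em; exact: einf_phi_infty_le.
  apply: (closure_sublevel_argmin em) => c mc; apply: pP.
    exact: midconvex_union_sublevel.
  have : \forall t \near +oo, (phi t (x t) < c%:E)%E.
    apply: (cvg_energy [set r | (r < c%:E)%E]).
    apply: open_nbhs_nbhs; split; first exact: open_ereal_lt_ereal.
    by rewrite /= em lte_fin.
  move=> /near_pinftyP[T HT]; exists (Num.max T 0) => t.
  by rewrite ge_max => /andP[/HT tT t0] _; exists t.
Qed.
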